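(* Let $U$ be a unicyclic graph on $n$ vertices. Then ${\rm pind}(B_{U})\leq 2$. Hence $U$ is $(1,3)$-choosable.
   Context: Graphs are finite and simple. A unicyclic graph is a connected graph containing exactly one cycle (equivalently, a connected graph whose number of edges equals its number of vertices). The permanent of an $m\times m$ real matrix $A=[a_{ij}]$ is ${\rm per}(A)=\sum_{\sigma}\prod_{i=1}^{m}a_{i\sigma(i)}$, summed over all permutations $\sigma$ of $\{1,\ldots,m\}$. The permanent index ${\rm pind}(A)$ of a matrix $A$ with $m$ rows is the minimum integer $k$ such that there is an $m\times m$ matrix $A'$ with ${\rm per}(A')\neq 0$, each column of which is a column of $A$, and such that each column of $A$ occurs in $A'$ at most $k$ times. For a graph $G$, fix an orientation of its edges. $B_G$ is the matrix with rows and columns both indexed by the edges of $G$, where for $e=(u,v)$ (oriented from $u$ to $v$) and an edge $y$, $B_G[e,y]=1$ if $y\neq e$ is incident to $v$; $B_G[e,y]=-1$ if $y\neq e$ is incident to $u$; and $B_G[e,y]=0$ otherwise. (Reversing an edge multiplies the corresponding row by $-1$, so ${\rm pind}(B_G)$ does not depend on the orientation.) A total-weighting of $G=(V,E)$ is a mapping $f:V\cup E\to\mathbb{R}$. For $v\in V$ put $s(v)=f(v)+\sum_{e\in E(v)}f(e)$, where $E(v)$ is the set of edges incident with $v$. The total-weighting $f$ is proper if $s(u)\neq s(v)$ for any two adjacent vertices $u,v$. The graph $G$ is $(k,k')$-choosable if for every assignment $L$ of a set $L(v)$ of $k$ real numbers to each vertex $v$ and a set $L(e)$ of $k'$ real numbers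 to each edge $e$, there is a proper total-weighting $f$ with $f(z)\in L(z)$ for all $z\in V\cup E$. *)

(* Defs.v *)
From mathcomp Require Import all_boot all_order all_fingroup all_algebra.
From mathcomp Require Import finmap.
From mathcomp Require Export reals.

Set Implicit Arguments.
Unset Strict Implicit.
Unset Printing Implicit Defensive.

Import GRing.Theory.
Local Open Scope ring_scope.

Record sgraph := SGraph {
  vertex :> finType;
  adj : rel vertex;
  adj_sym : symmetric adj;
  adj_irrefl : irreflexive adj
}.

Definition edge_set (G : sgraph) : {set {set G}} :=
  [set [set p.1; p.2] | p : G * G & adj p.1 p.2].

Definition edge (G : sgraph) : finType := {a : {set G} | a \in edge_set G}.

Definition connected (G : sgraph) : Prop := forall x y : G, connect (@adj G) x y.

(* Cycles are counted as subgraphs: a cycle is identified with its edge set,  *)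
(* so that the rotations and the reversal of a closed walk are the same cycle. *)
Definition is_cycle (G : sgraph) (C : {set {set G}}) : Prop :=
  exists p : seq G,
    [/\ ucycle (@adj G) p, (2 < size p)%N
      & C = [set [set x; next p x] | x in p]].

Definition unicyclic (G : sgraph) : Prop :=
  connected G /\ exists! C : {set {set G}}, is_cycle C.

Definition per (R : comNzRingType) (m : nat) (A : 'M[R]_m) : R :=
  \sum_(s : 'S_m) \prod_(i < m) A i (s i).

(* [g] selects the columns of A' among those of A; occurrences are counted by *)
(* column index, even if A has equal columns.                                 *)
Definition per_selectable (R : comNzRingType) (m n : nat) (A : 'M[R]_(m, n))
    (k : nat) : Prop :=
  exists g : 'I_m -> 'I_n,
    per (colsub g A) != 0 /\ forall j : 'I_n, (#|[set i | g i == j]| <= k)%N.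

(* The minimum need not exist for an arbitrary A, so "pind A = k" is a        *)
(* relation; existence of the minimum is part of a bound on pind A.           *)
Definition is_pind (R : comNzRingType) (m n : nat) (A : 'M[R]_(m, n))
    (k : nat) : Prop :=
  per_selectable A k /\ forall k' : nat, per_selectable A k' -> (k <= k')%N.

Definition pind_le (R : comNzRingType) (m n : nat) (A : 'M[R]_(m, n))
    (b : nat) : Prop :=
  exists2 k : nat, is_pind A k & (k <= b)%N.

(* [o a = (u, v)] means that [a] is oriented from [u] to [v]. *)
Definition is_orientation (G : sgraph) (o : edge G -> G * G) : Prop :=
  forall a : edge G, val a = [set (o a).1; (o a).2].

(* Edges are numbered by [enum_val]. Distinct edges share at most one vertex, *)
(* so the order of the two incidence tests is irrelevant.                     *)
Definition B_mx (R : comNzRingType) (G : sgraph) (o : edge G -> G * G) :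
    'M[R]_(#|edge G|) :=
  \matrix_(i, j)
    let a : edge G := enum_val i in
    let b : edge G := enum_val j in
    if b == a then 0
    else if (o a).2 \in val b then 1
    else if (o a).1 \in val b then -1
    else 0.

Definition total_weighting (R : realType) (G : sgraph) : Type :=
  (G + edge G)%type -> R.

Definition vsum (R : realType) (G : sgraph) (f : total_weighting R G) (v : G) :
    R :=
  f (inl v) + \sum_(a : edge G | v \in val a) f (inr a).

Definition proper_weighting (R : realType) (G : sgraph)
    (f : total_weighting R G) : Prop :=
  forall u v : G, adj u v -> vsum f u <> vsum f v.

Definition choosable (R : realType) (G : sgraph) (k k' : nat) : Prop :=
  forall L : (G + edge G)%type -> {fset R},
    (forall v : G, #|` L (inl v)| = k) ->
    (forall a : edge G, #|` L (inr a)| = k') ->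
    exists f : total_weighting R G,
      proper_weighting f /\ forall z : (G + edge G)%type, f z \in L z.

(* Main.v *)
Require Import Defs.
From mathcomp Require Import all_boot all_algebra.
From mathcomp Require Import all_fingroup finmap zify.

Set Implicit Arguments.
Unset Strict Implicit.
Unset Printing Implicit Defensive.

(** Orient every edge e and consider the product over all edges of the
    differences s(head of e) - s(tail of e), where s depends on the weights of
    the edges.  The part of highest degree of this polynomial is the product of
    the linear forms given by the rows of B_U, and its coefficients are, up to
    factorials, permanents of matrices made of columns of B_U.  So a nonzero
    permanent with every column used at most k times is a nonzero coefficient of
    a monomial with all exponents at most k, and the combinatorial
    Nullstellensatz ([permanent_nullstellensatz]) finds a nonzero value of the
    polynomial, that is a proper weighting, in lists of size k + 1.

    To find such columns for k = 2, give every edge a weight and let the row of e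
    select an edge of largest weight among those that meet e.  If all neighbours
    of e of that weight meet e at the same end, they have the same entry in the
    row of e.  A rearrangement of the selected columns keeps the total weight, so
    its term in the permanent is zero or selects an entry of largest weight in
    every row; all nonzero terms are then equal and cannot cancel
    ([per_coherent_neq0]).

    It remains to weight the edges so that no edge is selected more than twice.
    In a unicyclic graph, let f send a vertex of the cycle to the next one and any
    other vertex to its neighbour nearer to the cycle.  A further edge would close
    a second cycle, so the edges are exactly the {x, f x}, one for each vertex x
    ([unicyclic_functional]).  Call an edge {x, f x} off the cycle high if no high
    edge hangs at x; this is what one obtains by repeatedly stripping off a vertex
    all of whose neighbours but one are leaves, high edges being those that are
    pendant when they are removed.  High edges get the largest weights, growing
    with the distance to the cycle; then come the edges of the cycle; and last the
    other edges, the far ones below the near ones.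
    - An edge {x, f x} that is neither high nor on the cycle selects a high edge
      at x.
    - A high edge {x, f x} selects another high edge at f x, cyclically; if there
      is none it selects the edge {f x, f (f x)} or, when f x is on the cycle, the
      heavier of the two cycle edges at f x.
    - A cycle edge selects a high edge at one of its ends, if there is one, and
      otherwise the heavier of the two cycle edges next to it.
    A cycle edge is selected at most once from each of its ends, because there a
    lone high edge and the neighbouring cycle edge exclude each other.  A high edge
    hanging at v is selected by at most one other high edge, and besides only by
    {v, f v} or, when v is on the cycle, by the two cycle edges at v; if several
    high edges hang at v, these two select different ones, the first and the last. *)

(** * Permanents *)

Section Algebra.
Import GRing.Theory Num.Theory.
Local Open Scope ring_scope.

(** Only the terms of the permanent all of whose factors have the largest
    weight of their row survive, and each of them equals the term of the identity. *)
Lemma per_coherent_neq0 (R : numDomainType) (m : nat) (A : 'M[R]_m)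
    (h : 'I_m -> 'I_m) (w : 'I_m -> nat) :
  (forall i, A i (h i) != 0) ->
  (forall i j, A i j != 0 -> (w j <= w (h i))%N) ->
  (forall i j, A i j != 0 -> w j = w (h i) -> A i j = A i (h i)) ->
  per (colsub h A) != 0.
Proof.
move=> Ah0 wmax wtie; pose good (s : 'S_m) := [forall i, A i (h (s i)) != 0].
have perE : per (colsub h A) = \sum_(s | good s) \prod_i A i (h i).
  rewrite /per (bigID good) /= [X in _ + X]big1 ?addr0; last first.
    move=> s /forallPn[i /negPn/eqP Ai0]; apply/eqP/prodf_eq0.
    by exists i; rewrite // mxE Ai0.
  apply: eq_bigr => s /forallP gs; apply: eq_bigr => i _; rewrite mxE.
  (* Weights drop in every row, but the total weight is that of h itself. *)
  apply: wtie => //; apply/eqP; move: i (erefl true).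
  have le_w j : true -> (w (h (s j)) <= w (h j) ?= iff (w (h (s j)) == w (h j)))%N.
    by move=> _; apply/leqifP; rewrite ltn_neqAle wmax // andbT; case: eqP.
  have [_] := leqif_sum le_w.
  rewrite [X in X == _](_ : _ = \sum_j w (h j))%N; last first.
    by rewrite [RHS](reindex_inj (@perm_inj _ s)).
  by rewrite eqxx => /esym/forallP all_eq i _; exact: all_eq.
rewrite perE sumr_const -mulr_natr mulf_neq0 //.
  by apply/prodf_neq0.
rewrite pnatr_eq0 -lt0n; apply/card_gt0P; exists 1%g.
by apply/forallP => i; rewrite perm1.
Qed.

(** Extraction of the coefficient of degree e from polynomials of degree at most
    k, as a linear combination of values at k + 1 points. *)
Lemma vandermonde_weights (F : fieldType) (k : nat) (a : 'I_k.+1 -> F)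
    (e : 'I_k.+1) :
  injective a ->
  exists c : 'I_k.+1 -> F,
    forall d : nat, (d <= k)%N -> \sum_u c u * a u ^+ d = (d == e)%:R.
Proof.
move=> a_inj; pose V : 'M[F]_k.+1 := Vandermonde k.+1 (\row_u a u).
have Vunit : V \in unitmx.
  rewrite unitmxE det_Vandermonde unitfE; apply/prodf_neq0 => i _.
  apply/prodf_neq0 => j ltij; rewrite !mxE subr_eq0 (inj_eq a_inj).
  by rewrite -val_eqE /= gtn_eqF.
exists (fun u => (invmx V *m delta_mx e (0 : 'I_1)) u 0) => d le_dk.
have := congr1 (fun M : 'cV_k.+1 => M (Ordinal (le_dk : (d < k.+1)%N)) 0)
  (mulKVmx Vunit (delta_mx e (0 : 'I_1))).
rewrite !mxE andbT -val_eqE /= => <-.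
by apply: eq_bigr => u _; rewrite !mxE mulrC.
Qed.

Lemma sum_card_fibres (I J : finType) (q : I -> J) :
  (\sum_j #|[set i | q i == j]| = #|I|)%N.
Proof.
rewrite -[RHS]sum1_card (partition_big q xpredT) //=; apply: eq_bigr => j _.
by rewrite sum1_card; apply: eq_card => i; rewrite !inE.
Qed.

(** A monomial in n variables of an expanded product of m affine forms is a choice
    of one of n + 1 columns in each row: column [ord0] is the constant term, and the
    exponent of variable j is the number of rows that choose column j + 1. *)
Definition exponent (m n : nat) (q : 'I_m -> 'I_n.+1) (j : 'I_n) : nat :=
  #|[set i | q i == lift ord0 j]|.

Lemma sum_exponent (m n : nat) (q : 'I_m -> 'I_n.+1) :
  (#|[set i | q i == ord0]| + \sum_j exponent q j = m)%N.
Proof. by rewrite -[RHS]card_ord -(sum_card_fibres q) big_ord_recl. Qed.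

Lemma exponent_perm (m n : nat) (g : 'I_m -> 'I_n) (q : 'I_m -> 'I_n.+1) :
  (forall j, exponent q j = #|[set i | g i == j]|) ->
  exists s : 'S_m, forall i, q i = lift ord0 (g (s i)).
Proof.
move=> eqf; have q0 : #|[set i | q i == ord0]| = 0%N.
  (* The exponents already add up to m, so no row chooses its constant term. *)
  have := sum_exponent q.
  rewrite (eq_bigr _ (fun j _ => eqf j)) sum_card_fibres card_ord => /eqP.
  by rewrite -[X in _ == X]add0n eqn_add2r => /eqP.
have : perm_eq [seq q i | i <- enum 'I_m]
               (map_tuple (fun i => lift ord0 (g i)) (ord_tuple m)).
  rewrite [tval _](_ : _ = [seq lift ord0 (g i) | i <- enum 'I_m]); last first.
    by rewrite -val_ord_tuple.
  apply/allP => x _; apply/eqP; rewrite count_map [RHS]count_map.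
  have cntE (T : eqType) (r : 'I_m -> T) y :
      count (preim r (pred1 y)) (enum 'I_m) = #|[set i | r i == y]|.
    rewrite -sum1_count -sum1_card big_enum_cond /=.
    by apply: eq_bigl => i; rewrite !inE.
  transitivity #|[set i | q i == x]|; first exact: cntE.
  transitivity #|[set i | lift ord0 (g i) == x]|; last exact/esym/cntE.
  case: (unliftP ord0 x) => [j|] ->.
    rewrite -/(exponent q j) eqf; apply: eq_card => i.
    by rewrite !inE.
  transitivity 0%N; first exact: q0.
  by apply/esym/eqP; rewrite cards_eq0; apply/eqP/setP => i; rewrite !inE.
case/tuple_permP => s Es; exists s => i.
have := congr1 (fun r => nth ord0 r i) Es.
rewrite (nth_map i) ?size_enum_ord // nth_ord_enum => ->.
by rewrite -tnth_nth !(tnth_map, tnth_mktuple, tnth_ord_tuple).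
Qed.

(** Combinatorial Nullstellensatz for a product of affine forms with linear part A,
    at the monomial whose exponents are the column multiplicities K.  A linear
    combination [Lam] of the values on the grid extracts the coefficient of that
    monomial.  Degrees above k are not controlled in a single variable, but the
    total degree is at most the sum of the K j, so any other monomial has an
    exponent below K j for some j, and there the extraction gives zero. *)
Lemma permanent_nullstellensatz (F : fieldType) (m n k : nat) (A : 'M[F]_(m, n))
    (b : 'I_m -> F) (a : 'I_n -> 'I_k.+1 -> F) :
  per_selectable A k -> (forall j, injective (a j)) ->
  exists t : 'I_n -> 'I_k.+1,
    forall i, b i + \sum_j A i j * a j (t j) != 0.
Proof.
case=> g [per0 gk] a_inj; pose K j := #|[set i | g i == j]|.
have /fin_all_exists [c cE] j :=
  vandermonde_weights (Ordinal (gk j : (_ < k.+1)%N)) (a_inj j).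
pose var (t : 'I_n -> 'I_k.+1) o :=
  if unlift ord0 o is Some j then a j (t j) else 1.
pose coef i o := if unlift ord0 o is Some j then A i j else b i.
pose Pt (t : 'I_n -> 'I_k.+1) := \prod_i (b i + \sum_j A i j * a j (t j)).
have PtE t : Pt t = \sum_(q : {ffun 'I_m -> 'I_n.+1})
    (\prod_i coef i (q i)) * \prod_j a j (t j) ^+ exponent q j.
  transitivity (\prod_i \sum_o coef i o * var t o).
    apply: eq_bigr => i _; rewrite big_ord_recl /coef /var unlift_none mulr1.
    by congr (_ + _); apply: eq_bigr => j _; rewrite liftK.
  rewrite bigA_distr_bigA; apply: eq_bigr => q _; rewrite big_split /=.
  congr (_ * _); rewrite (partition_big q xpredT) //= big_ord_recl.
  rewrite big1 => [|i /eqP->]; last by rewrite /var unlift_none.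
  rewrite mul1r; apply: eq_bigr => j _; rewrite -prodr_const.
  apply: eq_big => [i|i /eqP->]; first by rewrite !inE.
  by rewrite /var liftK.
pose Lam := \sum_(t : {ffun 'I_n -> 'I_k.+1}) (\prod_j c j (t j)) * Pt t.
pose hit (q : {ffun 'I_m -> 'I_n.+1}) := [forall j, exponent q j == K j].
have LamE : Lam = \sum_(q | hit q) \prod_i coef i (q i).
  transitivity (\sum_(q : {ffun 'I_m -> 'I_n.+1}) (\prod_i coef i (q i)) *
      \prod_j \sum_u c j u * a j u ^+ exponent q j).
    rewrite /Lam; under eq_bigr do rewrite PtE big_distrr /=.
    rewrite exchange_big /=; apply: eq_bigr => q _.
    rewrite bigA_distr_bigA big_distrr /=; apply: eq_bigr => t _.
    by rewrite mulrCA -big_split.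
  rewrite (bigID hit) /= [X in _ + X]big1 ?addr0 => [|q nhit].
    apply: eq_bigr => q /forallP hq; rewrite [X in _ * X]big1 ?mulr1 // => j _.
    by rewrite cE (eqP (hq j)) ?eqxx ?gk.
  suff [j ltj] : exists j, (exponent q j < K j)%N.
    rewrite [X in _ * X](bigD1 j) //= cE ?(ltn_eqF ltj) ?mul0r ?mulr0 //.
    exact: leq_trans (ltnW ltj) (gk j).
  apply/existsP; apply: contraR nhit => /existsPn noj.
  have le_K j : true -> (K j <= exponent q j ?= iff (K j == exponent q j))%N.
    by move=> _; apply/leqifP; rewrite ltn_neqAle leqNgt noj andbT; case: eqP.
  have [le_sum] := leqif_sum le_K.
  have le_m : (\sum_j exponent q j <= \sum_j K j)%N.
    by rewrite sum_card_fibres card_ord -[leqRHS](sum_exponent q) leq_addl.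
  rewrite eqn_leq le_sum le_m => /esym/forallP all_eq.
  by apply/forallP => j; rewrite eq_sym; exact: all_eq.
(* Permutations giving the same monomial form a coset of the stabiliser of g, so the
   permanent is a multiple of the extracted coefficient. *)
pose stab := [set s : 'S_m | [forall i, g (s i) == g i]].
have perE : per (colsub g A) = Lam *+ #|stab|.
  pose q_of (s : 'S_m) := [ffun i => lift ord0 (g (s i)) : 'I_n.+1].
  rewrite /per (partition_big q_of hit) /= => [|s _]; last first.
    apply/forallP => j; apply/eqP; rewrite /K -[RHS](card_preimset _ (@perm_inj _ s)).
    by apply: eq_card => i; rewrite !inE ffunE (inj_eq lift_inj).
  rewrite LamE -sumrMnl; apply: eq_bigr => q /forallP hq.
  have [s0 Es0] := exponent_perm (fun j => eqP (hq j)).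
  rewrite -sumr_const (reindex_inj (mulgI s0)) /=; apply: eq_big => [s|s].
    rewrite inE; apply/eqP/forallP => [/ffunP Eq i|gs].
      have := Eq ((s0^-1)%g i); rewrite ffunE Es0 permM permKV.
      by move/lift_inj->.
    by apply/ffunP=> i; rewrite ffunE Es0 permM (eqP (gs _)).
  move=> /eqP/ffunP Eq; apply: eq_bigr => i _.
  by rewrite mxE -Eq ffunE /coef liftK.
have Lam0 : Lam != 0 by apply: contraNneq per0 => L0; rewrite perE L0 mul0rn.
have [t Pt0] : exists t : {ffun 'I_n -> 'I_k.+1}, Pt t != 0.
  apply/existsP; apply: contraNT Lam0 => /existsPn noP.
  by rewrite /Lam big1 // => t _; have := noP t; rewrite negbK => /eqP->; rewrite mulr0.
by exists t => i; have /prodf_neq0 := Pt0; apply.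
Qed.
End Algebra.

(** * Selecting edges in a functional graph *)

(** A graph whose edges are the {x, f x}: C is the vertex set of its cycles, g is the
    inverse of f on C, and d is the distance to C.  Vertices double as names of
    edges: below, edge x stands for {x, f x}. *)
Record functional_graph (V : finType) (f g : V -> V) (C : {set V})
    (d : V -> nat) : Prop := FunctionalGraph {
  fg_neq : forall x, f x != x;
  fg_neq2 : forall x, f (f x) != x;
  fg_C : forall x, x \in C -> f x \in C;
  fg_gC : forall x, x \in C -> g x \in C;
  fg_gK : {in C, cancel g f};
  fg_fK : {in C, cancel f g};
  fg_depth0 : forall x, x \in C -> d x = 0;
  fg_depthS : forall x, x \notin C -> d x = (d (f x)).+1
}.

(** Edge y meets edge x at its end x, respectively at its end f x. *)
Definition tail_adj (V : finType) (f : V -> V) (x y : V) := f y == x.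
Definition head_adj (V : finType) (f : V -> V) (x y : V) :=
  (y == f x) || (f y == f x) && (y != x).

(** Edge z is a heaviest neighbour of edge x, and all heaviest neighbours of x meet
    it at the same end as z. *)
Definition dominant (V : finType) (w : V -> nat) (x z : V)
    (side coside : rel V) : Prop :=
  [/\ side x z, forall y, side x y -> w y <= w z
    & forall y, coside x y -> w y < w z].

Section FunctionalGraph.
Local Open Scope nat_scope.
Variables (V : finType) (f g : V -> V) (C : {set V}) (d : V -> nat).
Hypothesis FG : functional_graph f g C d.
Let f_neq := fg_neq FG.
Let ff_neq := fg_neq2 FG.
Let fC := fg_C FG.
Let gC := fg_gC FG.
Let gK := fg_gK FG.
Let fK := fg_fK FG.
Let dC := fg_depth0 FG.
Let dS := fg_depthS FG.

Let D := \max_x d x.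
Let N := #|V|.
Let idx (x : V) : nat := enum_rank x.

Lemma le_dD x : d x <= D. Proof. exact: leq_bigmax. Qed.

(** High edges are the kernel of the relation from u to f u off the cycles.  The
    recursion climbs from the vertices farthest from C; the fuel n suffices at
    depth d x as soon as d x + n exceeds the maximal depth. *)
Lemma kernel_exists : exists hi : pred V,
  forall x, hi x = (x \notin C) && [forall u, hi u ==> (f u != x)].
Proof.
pose fix hin (n : nat) (x : V) {struct n} := if n is n'.+1 then
  (x \notin C) && [forall u, hin n' u ==> (f u != x)] else false.
have hinC n x : hin n x -> x \notin C by case: n => //= n /andP[].
have hinE n x : hin n.+1 x = (x \notin C) && [forall u, hin n u ==> (f u != x)] by [].
have hinS n x : d x + n > D -> hin n.+1 x = hin n x.
  elim: n x => [|n IHn] x ltD; first by have := le_dD x; lia.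
  rewrite hinE [RHS]hinE; congr andb.
  apply: eq_forallb => u; case: (eqVneq (f u) x) => [fux|]; last by rewrite !implybT.
  rewrite !implybF; congr (~~ _).
  have [uC|uC] := boolP (u \in C).
    have hinF k : hin k u = false by apply/negP => /hinC/negP.
    by rewrite !hinF.
  by apply: IHn; have := dS uC; rewrite fux; lia.
by exists (hin D.+1) => x; rewrite -hinS ?hinE //; lia.
Qed.

Section Selection.
Variable hi : pred V.
Hypothesis hiE : forall x, hi x = (x \notin C) && [forall u, hi u ==> (f u != x)].

Lemma hi_notC x : hi x -> x \notin C. Proof. by rewrite hiE => /andP[]. Qed.
Lemma C_nhi x : x \in C -> hi x = false. Proof. by rewrite hiE => ->. Qed.
Lemma hi_par x : hi x -> hi (f x) = false.
Proof.
move=> hx; rewrite hiE; apply/negbTE/nandP; right; apply/forallPn; exists x.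
by rewrite hx eqxx.
Qed.

Definition hi_kids v := [seq u <- enum V | hi u && (f u == v)].
Let K := hi_kids.
Lemma mem_K u v : (u \in K v) = hi u && (f u == v).
Proof. by rewrite mem_filter mem_enum andbT. Qed.
Lemma uniq_K v : uniq (K v). Proof. by rewrite filter_uniq ?enum_uniq. Qed.

Definition first_hi v := head v (K v).
Definition last_hi v := last v (K v).
Definition heavier a b := if idx a < idx b then b else a.

(** When both ends of a cycle edge carry high edges, the larger index wins, in
    agreement with [weight]; taking the first high edge at one end and the last one
    at the other keeps the two cycle edges at a vertex from selecting the same
    high edge. *)
Definition selected x :=
  if x \in C then
    if nilp (K x) && nilp (K (f x)) then heavier (g x) (f x)
    else if ~~ nilp (K x) && (nilp (K (f x)) || (idx (f x) < idx x)) then first_hi x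
    else last_hi (f x)
  else if hi x then
    if 1 < size (K (f x)) then next (K (f x)) x
    else if f x \in C then heavier (g (f x)) (f x) else f x
  else first_hi x.

(** Three ranges: below D, from D to D + N, and above.  Among high edges the depth
    decides first, since indices are below N; the index of f x separates high edges
    hanging at the two ends of a cycle edge, while those hanging at the same vertex
    are tied. *)
Definition weight x :=
  if x \in C then D + idx x
  else if hi x then D + N + d x * N + idx (f x)
  else D - d x.

Lemma other_end_hi x :
  nilp (K x) && nilp (K (f x)) = false ->
  ~~ nilp (K x) && (nilp (K (f x)) || (idx (f x) < idx x)) = false ->
  ~~ nilp (K (f x)).
Proof. by case: (nilp (K x)) => //=; case: nilp. Qed.

Lemma first_hi_K v : ~~ nilp (K v) -> first_hi v \in K v.
Proof. by rewrite /first_hi; case: (K v) => // a s _; rewrite mem_head. Qed.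
Lemma last_hi_K v : ~~ nilp (K v) -> last_hi v \in K v.
Proof. by rewrite /last_hi; case: (K v) => //= a s _; exact: mem_last. Qed.
Lemma first_hiP v : ~~ nilp (K v) -> hi (first_hi v) /\ f (first_hi v) = v.
Proof. by move/first_hi_K; rewrite mem_K => /andP[? /eqP]. Qed.
Lemma last_hiP v : ~~ nilp (K v) -> hi (last_hi v) /\ f (last_hi v) = v.
Proof. by move/last_hi_K; rewrite mem_K => /andP[? /eqP]. Qed.
Lemma K_nilP v u : hi u -> f u = v -> ~~ nilp (K v).
Proof.
move=> hu fu; have : u \in K v by rewrite mem_K hu fu eqxx.
by case: (K v).
Qed.
Lemma lo_K x : x \notin C -> ~~ hi x -> ~~ nilp (K x).
Proof.
move=> xC; rewrite hiE xC => /forallPn[u]; rewrite negb_imply negbK => /andP[hu /eqP fu].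
exact: K_nilP hu fu.
Qed.
Lemma first_last_hi v : 1 < size (K v) -> first_hi v != last_hi v.
Proof.
rewrite /first_hi /last_hi; have := uniq_K v; case: (K v) => [|a [|b s]] //= /andP[a_bs _] _.
by apply: contraNneq a_bs => ->; rewrite mem_last.
Qed.
Lemma K_single x y : size (K (f x)) <= 1 -> hi x -> hi y -> f y = f x -> y = x.
Proof.
move=> szK hx hy fyx.
have : x \in K (f x) by rewrite mem_K hx eqxx.
have : y \in K (f x) by rewrite mem_K hy fyx eqxx.
by case: (K (f x)) szK => [|a [|? ?]] //; rewrite !inE => _ /eqP-> /eqP->.
Qed.

Lemma idx_lt x : idx x < N. Proof. exact: ltn_ord. Qed.
Lemma idx_inj : injective idx.
Proof. by move=> x y /val_inj/enum_rank_inj. Qed.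

Lemma wC x : x \in C -> weight x = D + idx x.
Proof. by rewrite /weight => ->. Qed.
Lemma w_hi x : hi x -> weight x = D + N + d x * N + idx (f x).
Proof. by move=> hx; rewrite /weight (negbTE (hi_notC hx)) hx. Qed.
Lemma w_lo x : x \notin C -> ~~ hi x -> weight x = D - d x /\ 0 < d x.
Proof. by move=> xC hx; rewrite /weight (negbTE xC) (negbTE hx) dS. Qed.
Lemma w_hi_ge x : hi x -> D + N <= weight x.
Proof. by move/w_hi ->; lia. Qed.
Lemma w_nhi_lt x : ~~ hi x -> weight x < D + N.
Proof.
move=> hx; have [xC|xC] := boolP (x \in C).
  by rewrite wC //; have := idx_lt x; lia.
by have [-> _] := w_lo xC hx; have := idx_lt x; lia.
Qed.
Lemma w_lo_lt x y : x \notin C -> ~~ hi x -> y \in C -> weight x < weight y.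
Proof.
move=> xC hx yC; have [-> ?] := w_lo xC hx; rewrite wC //.
by have := le_dD x; lia.
Qed.
Lemma w_nhi_hi x y : ~~ hi x -> hi y -> weight x < weight y.
Proof. by move=> /w_nhi_lt ? /w_hi_ge; lia. Qed.
Lemma w_hi_lt x y : hi x -> hi y -> d x < d y -> weight x < weight y.
Proof.
move=> hx hy ltd; rewrite !w_hi //; have := idx_lt (f x).
have : (d x).+1 * N <= d y * N by rewrite leq_mul2r ltd orbT.
by rewrite mulSn; lia.
Qed.
Lemma w_hi_sib x y : hi x -> hi y -> f x = f y -> weight x = weight y.
Proof. by move=> hx hy fxy; rewrite !w_hi // (dS (hi_notC hx)) (dS (hi_notC hy)) fxy. Qed.
Lemma w_hi_C x y : hi x -> hi y -> f x \in C -> f y \in C ->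
  idx (f x) < idx (f y) -> weight x < weight y.
Proof.
by move=> hx hy fx fy lt_idx; rewrite !w_hi // (dS (hi_notC hx)) (dS (hi_notC hy)) !dC //; lia.
Qed.

Lemma heavierP a b : a \in C -> b \in C ->
  [/\ heavier a b = a \/ heavier a b = b, weight a <= weight (heavier a b)
    & weight b <= weight (heavier a b)].
Proof.
move=> aC bC; rewrite /heavier; case: ltnP => le_ab; rewrite !wC //; split=> //; auto; lia.
Qed.

Lemma selected_dominant x :
  dominant weight x (selected x) (tail_adj f) (head_adj f) \/
  dominant weight x (selected x) (head_adj f) (tail_adj f).
Proof.
rewrite /selected /tail_adj /head_adj; have [xC|xC] := boolP (x \in C).
  have gfx : g x != f x.
    by apply: contraNneq (ff_neq x) => <-; rewrite gK.
  case: ifP => [/andP[/nilP K0 /nilP Kf0]|nK].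
    have no_hi y : f y = x \/ f y = f x -> ~~ hi y.
      move=> fy; apply/negP => hy; case: fy => fy.
        by have := K_nilP hy fy; rewrite K0.
      by have := K_nilP hy fy; rewrite Kf0.
    have tailW y : f y == x -> y <> g x -> weight y < weight (g x) /\ weight y < weight (f x).
      move=> /eqP fy yg; have yC : y \notin C.
        by apply/negP => yC; apply: yg; rewrite -fy fK.
      by split; apply: w_lo_lt => //; auto.
    have headW y : f y == f x -> y != x -> weight y < weight (g x) /\ weight y < weight (f x).
      move=> /eqP fy yx; have yC : y \notin C.
        by apply: contraNN yx => yC; rewrite -(fK yC) fy fK.
      by split; apply: w_lo_lt => //; auto.
    (* A tie here would be at opposite ends of edge x. *)
    have neqW : weight (g x) <> weight (f x).
      rewrite !wC ?gC ?fC // => /addnI /idx_inj E.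
      by rewrite E eqxx in gfx.
    have [[E|E]] := heavierP (gC xC) (fC xC); rewrite E => leg lef.
      left; split=> [|y fy|y /orP[/eqP->|/andP[fy yx]]].
      - by rewrite gK.
      - by have [->//|/eqP/(tailW _ fy)[]] := eqVneq y (g x); lia.
      - lia.
      - by have [] := headW _ fy yx.
    right; split=> [|y /orP[/eqP->//|/andP[fy yx]]|y fy].
    - by rewrite eqxx.
    - by have [] := headW _ fy yx; lia.
    - have [->//|/eqP/(tailW _ fy)[]] := eqVneq y (g x); lia.
  case: ifP => [/andP[Kx Kfx]|nKx].
    have [hh fh] := first_hiP Kx; left; split=> [|y /eqP fy|y /orP[/eqP->|/andP[/eqP fy yx]]].
    - by rewrite fh.
    - have [hy|/w_nhi_hi/(_ hh)/ltnW//] := boolP (hi y).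
      by rewrite (w_hi_sib hy hh) ?fy ?fh.
    - by apply: w_nhi_hi => //; rewrite C_nhi ?fC.
    - have [hy|/w_nhi_hi/(_ hh)//] := boolP (hi y).
      apply: w_hi_C => //; rewrite ?fh ?fy ?fC //.
      by case/orP: Kfx => // Kfx; have := K_nilP hy fy; rewrite Kfx.
  have Kfx := other_end_hi nK nKx.
  have [hh fh] := last_hiP Kfx; right.
  split=> [|y /orP[/eqP->|/andP[/eqP fy yx]]|y /eqP fy].
  - have hx : last_hi (f x) != x.
      by apply: contraTneq hh => ->; rewrite C_nhi.
    by rewrite fh eqxx hx orbT.
  - by apply/ltnW/w_nhi_hi => //; rewrite C_nhi ?fC.
  - have [hy|/w_nhi_hi/(_ hh)/ltnW//] := boolP (hi y).
    by rewrite (w_hi_sib hy hh) ?fy ?fh.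
  - have [hy|/w_nhi_hi/(_ hh)//] := boolP (hi y).
    apply: w_hi_C => //; rewrite ?fh ?fy ?fC //.
    have := K_nilP hy fy; move: nKx; rewrite (negbTE Kfx) /= => /[swap] -> /= /negbT.
    rewrite -leqNgt leq_eqVlt => /orP[/eqP/idx_inj E|//].
    by have := f_neq x; rewrite -E eqxx.
have [hx|hx] := boolP (hi x); last first.
  have [hh fh] := first_hiP (lo_K xC hx); have hhC := hi_notC hh.
  left; split=> [|y /eqP fy|y /orP[/eqP->|/andP[/eqP fy yx]]].
  - by rewrite fh.
  - have [hy|/w_nhi_hi/(_ hh)/ltnW//] := boolP (hi y).
    by rewrite (w_hi_sib hy hh) ?fy ?fh.
  - have [hy|/w_nhi_hi/(_ hh)//] := boolP (hi (f x)).
    by apply: w_hi_lt => //; have := dS hhC; rewrite fh (dS xC); lia.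
  - have [hy|/w_nhi_hi/(_ hh)//] := boolP (hi y).
    by apply: w_hi_lt => //; have := dS hhC; rewrite fh (dS xC) (dS (hi_notC hy)) fy; lia.
have kid y : f y = x -> ~~ hi y.
  by move=> fy; apply/negP => /hi_par; rewrite fy hx.
have kidC y : f y = x -> y \notin C.
  by move=> fy; apply/negP => /fC; rewrite fy (negbTE xC).
have nhf : ~~ hi (f x) by rewrite hi_par.
have xK : x \in K (f x) by rewrite mem_K hx eqxx.
case: ltnP => szK.
  have zK : next (K (f x)) x \in K (f x) by rewrite mem_next.
  have [hz fz] : hi (next (K (f x)) x) /\ f (next (K (f x)) x) = f x.
    by move: zK; rewrite mem_K => /andP[? /eqP].
  right; split=> [|y /orP[/eqP->|/andP[/eqP fy yx]]|y /eqP fy].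
  - rewrite fz eqxx orbC /=; apply/orP; left.
    have := uniq_K (f x); move: xK szK; case/rot_to => i s rotK szK uK.
    rewrite -(next_rot i uK) rotK /=.
    have := size_rot i (K (f x)); have := rot_uniq i (K (f x)).
    rewrite rotK uK; case: s {rotK} => [|b s] /=; first by move=> _ E; rewrite -E in szK.
    by rewrite eqxx inE eq_sym; case: eqP.
  - exact/ltnW/w_nhi_hi.
  - have [hy|/w_nhi_hi/(_ hz)/ltnW//] := boolP (hi y).
    by rewrite (w_hi_sib hy hz) ?fy ?fz.
  - by apply: w_nhi_hi => //; exact: kid.
have sib y : f y = f x -> y != x -> ~~ hi y.
  by move=> fy; apply: contraNN => hy; apply/eqP; exact: K_single fy.
right; have [fxC|fxC] := boolP (f x \in C).
  have gfC := gC fxC; have ffg := gK fxC.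
  have hC : heavier (g (f x)) (f x) \in C by rewrite /heavier; case: ifP.
  have [hE leg lef] := heavierP gfC fxC.
  split=> [|y /orP[/eqP->//|/andP[/eqP fy yx]]|y /eqP fy].
  - case: hE => ->; rewrite ?eqxx // ffg eqxx; apply/orP; right.
    by apply: contraNneq xC => <-.
  - have [yC|yC] := boolP (y \in C); first by rewrite -(fK yC) fy.
    by apply/ltnW/w_lo_lt => //; exact: sib.
  - by apply: w_lo_lt; [exact: kidC | exact: kid |].
have [wfx _] := w_lo fxC nhf.
split=> [|y /orP[/eqP->//|/andP[/eqP fy yx]]|y /eqP fy].
- by rewrite eqxx.
- have yC : y \notin C by apply: contraNN fxC => /fC; rewrite fy.
  have [-> _] := w_lo yC (sib _ fy yx); rewrite wfx (dS yC) fy; lia.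
- have yC := kidC _ fy; have [-> _] := w_lo yC (kid _ fy).
  by have := le_dD x; have := dS xC; rewrite wfx (dS yC) fy; lia.
Qed.

(** The two possible selectors of y are listed explicitly.  A cycle edge is selected
    once from each end.  A high edge y at v = f y is selected by its predecessor among
    the high edges at v, if there are several, and by edge v if y is the first of them
    or by the cycle edge before v if y is the last; a lone high edge can be selected
    by both of the latter. *)
Lemma card_selectors y : #|[set x | selected x == y]| <= 2.
Proof.
suff [a [b sub]] : exists a b, forall x, selected x = y -> x = a \/ x = b.
  apply: leq_trans (_ : #|[set a; b]| <= 2); last by rewrite cards2; case: eqP.
  apply/subset_leq_card/subsetP => x; rewrite !inE => /eqP/sub[]->.
    by rewrite eqxx.
  by rewrite eqxx orbT.
have heavyC a b : a \in C -> b \in C -> heavier a b \in C.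
  by rewrite /heavier; case: ifP.
have [yC|yC] := boolP (y \in C).
  exists (if nilp (K y) then g y else first_hi y), (if nilp (K (f y)) then f y else first_hi (f y)).
  have first_hiE x : hi x -> size (K (f x)) <= 1 -> x = first_hi (f x).
    move=> hx szK; have [hh fh] := first_hiP (K_nilP hx erefl).
    by apply: esym; apply: K_single.
  move=> x; rewrite /selected; case: ifP => [xC|/negbT xC].
    case: ifP => [/andP[K0 Kf0]|nK].
      have [[->|->] _ _] := heavierP (gC xC) (fC xC) => E.
        by right; rewrite -E gK // K0.
      by left; rewrite -E Kf0 fK.
    case: ifP => [/andP[Kx _]|nKx] E.
      by have [] := first_hiP Kx; rewrite E C_nhi.
    have Kfx := other_end_hi nK nKx.
    by have [] := last_hiP Kfx; rewrite E C_nhi.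
  case: ifP => [hx|/negbT hx] => [|E]; last first.
    by have [] := first_hiP (lo_K xC hx); rewrite E C_nhi.
  have Kfx := K_nilP hx erefl.
  case: ltnP => szK.
    move=> E; have : y \in K (f x) by rewrite -E mem_next mem_K hx eqxx.
    by rewrite mem_K C_nhi.
  case: ifP => [fxC|/negbT fxC] => [|E]; last by rewrite E yC in fxC.
  have [[->|->] _ _] := heavierP (gC fxC) fxC => E.
    by right; rewrite -E gK // (negbTE Kfx); exact: first_hiE.
  by left; rewrite -E (negbTE Kfx); exact: first_hiE.
have [hy|hy] := boolP (hi y); last first.
  exists (first_hi y), (first_hi y) => x; rewrite /selected; case: ifP => [xC|/negbT xC].
    case: ifP => [_ E|nK].
      by have := heavyC _ _ (gC xC) (fC xC); rewrite E (negbTE yC).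
    case: ifP => [/andP[Kx _]|nKx] E.
      by have [] := first_hiP Kx; rewrite E (negbTE hy).
    have Kfx := other_end_hi nK nKx.
    by have [] := last_hiP Kfx; rewrite E (negbTE hy).
  case: ifP => [hx|/negbT hx] => [|E]; last first.
    by have [] := first_hiP (lo_K xC hx); rewrite E (negbTE hy).
  case: ltnP => szK.
    move=> E; have : y \in K (f x) by rewrite -E mem_next mem_K hx eqxx.
    by rewrite mem_K (negbTE hy).
  case: ifP => [fxC E|/negbT fxC E].
    by have := heavyC _ _ (gC fxC) fxC; rewrite E (negbTE yC).
  left; have [hh fh] := first_hiP (K_nilP hx erefl).
  by rewrite -E; apply: esym; apply: K_single.
exists (if 1 < size (K (f y)) then prev (K (f y)) y else g (f y)).
exists (if (1 < size (K (f y))) && (y != first_hi (f y)) then g (f y) else f y).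
move=> x; rewrite /selected; case: ifP => [xC|/negbT xC].
  case: ifP => [_ E|nK].
    by have := heavyC _ _ (gC xC) (fC xC); rewrite E (negbTE yC).
  case: ifP => [/andP[Kx _]|nKx] E.
    by have [_ fh] := first_hiP Kx; right; rewrite -E fh eqxx andbF.
  have Kfx := other_end_hi nK nKx.
  have [_ fh] := last_hiP Kfx; rewrite -E fh fK //.
  case: ltnP => szK; last by left.
  by right; rewrite eq_sym first_last_hi.
case: ifP => [hx|/negbT hx] => [|E]; last first.
  by have [_ fh] := first_hiP (lo_K xC hx); right; rewrite -E fh eqxx andbF.
case: ltnP => szK.
  move=> E; have : y \in K (f x) by rewrite -E mem_next mem_K hx eqxx.
  rewrite mem_K hy => /= /eqP ->; rewrite szK; left.
  by rewrite -E prev_next ?uniq_K.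
case: ifP => [fxC E|/negbT fxC E].
  by have := heavyC _ _ (gC fxC) fxC; rewrite E (negbTE yC).
by have := hi_par hx; rewrite E hy.
Qed.

End Selection.

Lemma dominant_selection_exists : exists (h : V -> V) (w : V -> nat),
  (forall y, #|[set x | h x == y]| <= 2) /\
  forall x, dominant w x (h x) (tail_adj f) (head_adj f) \/
            dominant w x (h x) (head_adj f) (tail_adj f).
Proof.
have [hi hiE] := kernel_exists; exists (selected hi), (weight hi).
by split; [exact: card_selectors | exact: selected_dominant].
Qed.
End FunctionalGraph.

(** * Unicyclic graphs *)

Lemma distance_to (G : sgraph) (S : {set G}) :
  connected G -> S != set0 ->
  exists d : G -> nat,
    (forall x, x \in S -> d x = 0) /\
    (forall x, x \notin S -> exists2 y, adj x y & d x = (d y).+1).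
Proof.
move=> connG /set0Pn[x0 Sx0].
pose step (A : {set G}) := A :|: [set y | [exists x in A, adj x y]].
pose reach n := iter n step S.
have reachS n x y : x \in reach n -> adj x y -> y \in reach n.+1.
  move=> rx xy; rewrite /reach iterS !inE; apply/orP; right.
  by apply/existsP; exists x; rewrite rx.
have reach_path q x n : x \in reach n -> path (@adj G) x q ->
    exists k, last x q \in reach k.
  elim: q x n => [|y q IHq] x n rx /=; first by exists n.
  by case/andP=> xy; apply: IHq (reachS _ _ _ rx xy).
have reached x : exists n, x \in reach n.
  by have /connectP[q x0q ->] := connG x0 x; exact: (reach_path _ _ 0).
pose d x := ex_minn (reached x).
have d_reach x : x \in reach (d x) by rewrite /d; case: ex_minnP.
have d_min x n : x \in reach n -> d x <= n.
  by rewrite /d; case: ex_minnP => k _ min /min.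
exists d; split=> x Sx; first by apply/eqP; rewrite -leqn0 d_min.
case Dx: (d x) (d_reach x) => [|n]; first by rewrite (negbTE Sx).
rewrite /reach iterS !inE => /orP[/d_min|/existsP[y /andP[ry yx]]].
  by rewrite Dx ltnn.
exists y; first by rewrite adj_sym.
congr _.+1; apply/eqP; rewrite eqn_leq d_min // andbT.
by rewrite -ltnS -Dx d_min // (reachS _ y).
Qed.

Lemma next_next_neq (T : eqType) (p : seq T) x :
  uniq p -> 2 < size p -> x \in p -> next p (next p x) != x.
Proof.
move=> Up szp /rot_to[i s rotp].
have nextE y : next p y = next (rot i p) y by rewrite next_rot.
rewrite !nextE; move: szp Up; rewrite -(size_rot i) -(rot_uniq i) rotp => szp Up.
case: s szp Up {rotp nextE} => [|y [|z s]] //= _.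
rewrite !inE !eqxx !negb_or => /and3P[/and3P[xy xz _] /andP[yz _] _].
by rewrite (eq_sym y x) (negbTE xy) eq_sym xz.
Qed.

Lemma next_last (T : eqType) (x : T) (q : seq T) :
  uniq (x :: q) -> next (x :: q) (last x q) = x.
Proof.
case: (lastP q) => [|s y]; first by rewrite /= eqxx.
rewrite last_rcons -rcons_cons => Up; rewrite -(next_rotr 1 Up) rotr1_rcons.
by rewrite /= eqxx.
Qed.

(** An edge {x, y} that is not of the form {z, f z}, together with a simple path
    from x to y along edges of that form, would be a cycle through {x, y}, hence
    different from the given one. *)
Lemma unicyclic_functional (U : sgraph) : unicyclic U ->
  exists (f g : U -> U) (C : {set U}) (d : U -> nat),
    [/\ functional_graph f g C d, forall x, adj x (f x)
      & forall x y, adj x y -> y = f x \/ x = f y].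
Proof.
case=> connU [C0 [[p [/andP[cyc_p Up] szp C0E]] C0_uniq]].
have p0 : [set x in p] != set0.
  by case: p szp {cyc_p Up C0E} => // x p _; apply/set0Pn; exists x; rewrite !inE eqxx.
have [d [d0 dS]] := distance_to connU p0.
pose parent x := [pick y | adj x y && (d x == (d y).+1)].
pose f x := if x \in p then next p x else odflt x (parent x).
have f_in x : x \in p -> f x = next p x by rewrite /f => ->.
have f_out x : x \notin p -> adj x (f x) /\ d x = (d (f x)).+1.
  move=> xp; rewrite /f (negbTE xp) /parent; case: pickP => [y /andP[xy /eqP]//|none].
  have /dS[y xy dxy] : x \notin [set x in p] by rewrite inE.
  by have := none y; rewrite xy dxy eqxx.
have adj_f x : adj x (f x).
  have [xp|/f_out[]//] := boolP (x \in p).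
  by rewrite f_in //; exact: next_cycle.
have f_neq x : f x != x.
  by apply: contraTneq (adj_f x) => ->; rewrite adj_irrefl.
have ff_neq x : f (f x) != x.
  have [xp|xp] := boolP (x \in p).
    by rewrite (f_in x xp) f_in ?mem_next // next_next_neq.
  have [_ dx] := f_out x xp; have [fxp|fxp] := boolP (f x \in p).
    by apply: contraNneq xp => <-; rewrite f_in ?mem_next.
  have [_ dfx] := f_out _ fxp.
  by apply/eqP => E; move: dx; rewrite dfx E; lia.
pose e := [rel x y | (y == f x) || (x == f y)].
have e_sym : symmetric e by move=> x y; rewrite /= orbC.
have e_f x : connect e x (f x) by apply: connect1; rewrite /= eqxx.
have to_p x : exists2 c, c \in p & connect e x c.
  have [n] := ubnP (d x); elim: n x => // n IHn x ltd.
  have [xp|xp] := boolP (x \in p); first by exists x.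
  have [_ dx] := f_out x xp.
  have [|c cp fxc] := IHn (f x); first by lia.
  by exists c => //; apply: connect_trans fxc.
have in_p x y : x \in p -> y \in p -> connect e x y.
  move=> xp yp.
  have fcyc : fcycle f p.
    have := cycle_next Up; congr is_true; apply: eq_in_cycle (allss p) => a b ap _ /=.
    by rewrite f_in.
  have : fconnect f x y by rewrite (fconnect_cycle fcyc).
  by apply: connect_sub => a b /eqP <-.
have e_conn x y : connect e x y.
  have [a ap xa] := to_p x; have [b bp yb] := to_p y.
  apply: connect_trans xa (connect_trans (in_p _ _ ap bp) _).
  by rewrite (sym_connect_sym e_sym).
exists f, (prev p), [set x in p], d; split=> //.
  split=> // [x|x|x|x|x]; rewrite ?inE => xp.
  - by rewrite f_in ?mem_next.
  - by rewrite mem_prev.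
  - by rewrite f_in ?mem_prev // next_prev.
  - by rewrite f_in // prev_next.
  - by have [] := f_out x xp.
move=> x y xy.
have [->|yfx] := eqVneq y (f x); first by left.
have [->|xfy] := eqVneq x (f y); first by right.
have /connectP[q0 q0_path y_last] := e_conn x y.
case/shortenP: q0_path y_last => q q_path Uq _ y_last.
have adj_q : path (@adj U) x q.
  apply: sub_path q_path => a b /orP[]/eqP->; first exact: adj_f.
  by rewrite adj_sym; exact: adj_f.
have sz_q : 1 < size q.
  case: q q_path y_last {Uq adj_q} => [|a [|b q]] //= => [_|/andP[xa _]] E.
    by rewrite E adj_irrefl in xy.
  by rewrite -E (negbTE yfx) (negbTE xfy) in xa.
pose C2 := [set [set a; next (x :: q) a] | a in x :: q].
have : is_cycle C2.
  exists (x :: q); split=> //; rewrite /ucycle Uq andbT /= rcons_path adj_q.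
  by rewrite -y_last adj_sym.
move/C0_uniq => C02.
have : [set y; x] \in C2.
  apply/imsetP; exists y; first by rewrite y_last mem_last.
  by rewrite y_last next_last.
rewrite -C02 C0E => /imsetP[z zp]; rewrite -f_in // => yxz.
have xneqy : x != y by apply: contraTneq xy => ->; rewrite adj_irrefl.
have : x \in [set z; f z] by rewrite -yxz !inE eqxx orbT.
have : y \in [set z; f z] by rewrite -yxz !inE eqxx.
rewrite !inE => /orP[]/eqP yz /orP[]/eqP xz; move: xneqy yfx xfy; rewrite yz xz ?eqxx //.
Qed.

(** * Weightings and the matrix of a graph *)

Section Graphs.
Import GRing.Theory Num.Theory.
Local Open Scope ring_scope.

Lemma set2_eq (T : finType) (a b c d : T) :
  [set a; b] = [set c; d] -> (a = c /\ b = d) \/ (a = d /\ b = c).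
Proof.
move/setP => E; have := (E a, E b, E c, E d).
rewrite !inE !eqxx !orbT /= => -[[[Ea Eb] Ec] Ed].
case/esym/orP: Ea => /eqP Ea; case/esym/orP: Eb => /eqP Eb; subst; auto.
- by move: Ed; rewrite orbb => /eqP ->; auto.
- by move: Ec; rewrite orbb => /eqP ->; auto.
Qed.

Lemma edge_ends (G : sgraph) (a : edge G) :
  exists p : G * G, adj p.1 p.2 /\ val a = [set p.1; p.2].
Proof. by have /imsetP[p pE aE] := valP a; exists p; split=> //; rewrite inE in pE. Qed.

Lemma orientation_exists (G : sgraph) :
  exists o : edge G -> G * G, is_orientation o.
Proof.
have /fin_all_exists[o oP] (a : edge G) := edge_ends a.
by exists o => a; have [] := oP a.
Qed.

Lemma adj_edge (G : sgraph) (x y : G) : adj x y ->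
  [set x; y] \in edge_set G.
Proof. by move=> xy; apply/imsetP; exists (x, y); rewrite ?inE. Qed.

Lemma orientation_neq (G : sgraph) (o : edge G -> G * G) (a : edge G) :
  is_orientation o -> (o a).1 != (o a).2.
Proof.
move=> /(_ a) oE; have [p [adj_p pE]] := edge_ends a.
apply: contraTneq adj_p => o12; move: oE; rewrite pE => /set2_eq.
by rewrite o12 => -[] [-> ->]; rewrite adj_irrefl.
Qed.

(** Column b is the sum of the signed incidence columns of the two ends of b, which
    cancel on the diagonal. *)
Lemma B_mxE (R : comNzRingType) (G : sgraph) (o : edge G -> G * G) i j :
  is_orientation o ->
  B_mx R o i j = ((o (enum_val i)).2 \in val (enum_val j))%:R
                 - ((o (enum_val i)).1 \in val (enum_val j))%:R.
Proof.
move=> oP; rewrite mxE /=; set a := enum_val i; set b := enum_val j.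
have [->|b_neq] := eqVneq b a; first by rewrite oP !inE !eqxx orbT subrr.
have [o2b|o2b] := boolP ((o a).2 \in val b); last first.
  by case: ifP; rewrite sub0r // oppr0.
suff /negbTE-> : (o a).1 \notin val b by rewrite subr0.
apply: contraNN b_neq => o1b; apply/eqP/val_inj/eqP.
rewrite eq_sym eqEcard; apply/andP; split.
  by rewrite oP; apply/subsetP => v; rewrite !inE => /orP[]/eqP->.
by rewrite !oP !cards2 !orientation_neq.
Qed.

(** Functions on ordinals range over a finite type, so the property is decidable and a
    least k can be found. *)
Lemma per_selectableP (R : comNzRingType) (m n : nat) (A : 'M[R]_(m, n)) k :
  reflect (per_selectable A k)
    [exists g : {ffun 'I_m -> 'I_n}, (per (colsub g A) != 0) &&
       [forall j, (#|[set i | g i == j]| <= k)%N]].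
Proof.
apply: (iffP existsP) => [[g /andP[per0 /forallP gk]]|[g [per0 gk]]].
  by exists g.
exists (finfun g); apply/andP; split.
  suff -> : colsub (finfun g) A = colsub g A by [].
  by apply/matrixP => i j; rewrite !mxE ffunE.
apply/forallP => j; apply: leq_trans (gk j); apply/eq_leq/eq_card => i.
by rewrite !inE ffunE.
Qed.

Lemma per_selectable_pind_le (R : comNzRingType) (m n : nat)
    (A : 'M[R]_(m, n)) k : per_selectable A k -> pind_le A k.
Proof.
move=> /per_selectableP Ak.
have := ex_minnP (ex_intro (fun k => _ : bool) k Ak) => -[k0 Ak0 k0_min].
exists k0; last exact: k0_min.
by split=> [|k']; [apply/per_selectableP | move/per_selectableP; exact: k0_min].
Qed.

(** With the vertex weights forced, the difference of the sums at the ends of an edge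
    is the value of the affine form of its row. *)
Lemma per_selectable_choosable (R : realType) (G : sgraph)
    (o : edge G -> G * G) (k : nat) :
  is_orientation o -> per_selectable (B_mx R o) k -> choosable R G 1 k.+1.
Proof.
move=> oP selB L szV szE.
pose c v := nth 0 (L (inl v)) 0.
pose a (j : 'I_#|edge G|) (t : 'I_k.+1) : R := nth 0 (L (inr (enum_val j))) t.
have a_inj j : injective (a j).
  move=> t u /eqP; rewrite nth_uniq ?szE ?fset_uniq ?ltn_ord //.
  by move/eqP/val_inj.
pose b (i : 'I_#|edge G|) := c (o (enum_val i)).2 - c (o (enum_val i)).1.
have [t tP] := permanent_nullstellensatz b selB a_inj.
pose w z := match z with
  | inl v => c v
  | inr e => a (enum_rank e) (t (enum_rank e)) end.
have w_edges v : \sum_(e : edge G | v \in val e) w (inr e) =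
    \sum_(j < #|edge G|) (v \in val (enum_val j : edge G))%:R * a j (t j).
  rewrite big_mkcond (reindex (@enum_val (edge G) (edge G))) /=; last first.
    exact/onW_bij/enum_val_bij.
  apply: eq_bigr => j _; rewrite enum_valK.
  by case: ifP; rewrite ?mul1r ?mul0r.
have vsum_diff e : vsum w (o e).2 != vsum w (o e).1.
  rewrite -subr_eq0; have := tP (enum_rank e); congr (_ != 0).
  rewrite /vsum !w_edges opprD addrACA /b enum_rankK; congr (_ + _).
  rewrite -sumrB; apply: eq_bigr => j _.
  by rewrite B_mxE // enum_rankK mulrBl.
exists w; split=> [u v uv|[v|e]].
- pose e : edge G := exist _ [set u; v] (adj_edge uv).
  have /set2_eq[[-> ->]|[-> ->]] := oP e; apply/eqP; last exact: vsum_diff.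
  by rewrite eq_sym vsum_diff.
- by rewrite /= /c mem_nth // szV.
- by rewrite /= /a enum_rankK mem_nth // szE.
Qed.

Lemma unicyclic_per_selectable (R : numDomainType) (U : sgraph)
    (o : edge U -> U * U) :
  unicyclic U -> is_orientation o -> per_selectable (B_mx R o) 2.
Proof.
move=> /unicyclic_functional[f [g [C [d [FG adj_f adjP]]]]] oP.
have [h [w [h_fibre h_dom]]] := dominant_selection_exists FG.
have f_neq := fg_neq FG; have ff_neq := fg_neq2 FG.
pose phi x : edge U := exist _ [set x; f x] (adj_edge (adj_f x)).
have phi_inj : injective phi.
  move=> x y /(congr1 val)/set2_eq[[]//|[xfy fxy]].
  by have := ff_neq x; rewrite fxy xfy eqxx.
have /fin_all_exists[psi psiK] (e : edge U) : exists x, phi x = e.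
  have [[u v] /= [/adjP uv eE]] := edge_ends e.
  by case: uv => E; [exists u | exists v]; apply: val_inj; rewrite /= eE E // setUC.
have phiK x : psi (phi x) = x by apply: phi_inj; rewrite psiK.
pose vx (i : 'I_#|edge U|) := psi (enum_val i); pose ix x := enum_rank (phi x).
have ixK : cancel ix vx by move=> x; rewrite /vx /ix enum_rankK phiK.
have vxK : cancel vx ix by move=> i; rewrite /vx /ix psiK enum_valK.
have in_edge v j : (v \in val (enum_val j : edge U)) = (v == vx j) || (v == f (vx j)).
  by rewrite -[enum_val j]psiK !inE.
have excl x y : tail_adj f x y -> ~~ head_adj f x y.
  rewrite /tail_adj /head_adj => /eqP <-; rewrite negb_or negb_and.
  by rewrite [y == _]eq_sym ff_neq [f y == _]eq_sym f_neq.
(* The sign s records whether the orientation of edge x runs from x to f x. *)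
have BE i : exists2 s : R, s != 0 & forall j,
    B_mx R o i j = if head_adj f (vx i) (vx j) then s
                   else if tail_adj f (vx i) (vx j) then - s else 0.
  have nb j : ((vx i \in val (enum_val j : edge U))%:R : R) =
      (j == i)%:R + (tail_adj f (vx i) (vx j))%:R.
    rewrite in_edge /tail_adj eq_sym (can_eq vxK) [vx i == _]eq_sym.
    have [->|_] := eqVneq j i; last by rewrite add0r.
    by rewrite (negbTE (f_neq _)) addr0.
  have hb j : ((f (vx i) \in val (enum_val j : edge U))%:R : R) =
      (j == i)%:R + (head_adj f (vx i) (vx j))%:R.
    rewrite in_edge /head_adj [f (vx i) == vx j]eq_sym [f (vx i) == _]eq_sym (can_eq vxK).
    have [->|_] := eqVneq j i; last by rewrite add0r andbT.
    by rewrite eqxx orbT andbF orbF eq_sym (negbTE (f_neq _)) addr0.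
  have oE : [set vx i; f (vx i)] = [set (o (enum_val i)).1; (o (enum_val i)).2].
    by rewrite -oP -[in RHS](psiK (enum_val i)).
  have hd01 j := excl (vx i) (vx j).
  case/set2_eq: oE => -[o1 o2]; [exists 1; first exact: oner_neq0 | exists (-1)].
  - move=> j; rewrite B_mxE // -o1 -o2 nb hb opprD addrACA subrr add0r.
    by move: (hd01 j); case: tail_adj => [/(_ isT)/negbTE->|_];
       last case: head_adj; rewrite ?subr0 ?sub0r.
  - by rewrite oppr_eq0 oner_neq0.
  - move=> j; rewrite B_mxE // -o1 -o2 nb hb opprD addrACA subrr add0r.
    by move: (hd01 j); case: tail_adj => [/(_ isT)/negbTE->|_];
       last case: head_adj; rewrite ?subr0 ?sub0r ?opprK ?oppr0.
exists (ix \o h \o vx); split; last first.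
  move=> j; rewrite -(card_imset _ (can_inj vxK)).
  apply: leq_trans (h_fibre (vx j)); apply/subset_leq_card/subsetP => x.
  by case/imsetP => i; rewrite !inE => /eqP <- ->; rewrite ixK.
apply: (per_coherent_neq0 (w := w \o vx)) => [i|i j|i j] /=;
  have [s s0 Bi] := BE i; rewrite !Bi !ixK.
- case: (h_dom (vx i)) => -[side _ _]; last by rewrite side.
  by rewrite (negbTE (excl _ _ side)) side oppr_eq0.
- case: (h_dom (vx i)) => -[_ le lt];
    case: ifP => [hd _|_]; [exact/ltnW/lt | | exact: le |];
    case: ifP => [tl _|_]; rewrite ?eqxx //; [exact: le | exact/ltnW/lt].
- case: (h_dom (vx i)) => -[side le lt].
    rewrite (negbTE (excl _ _ side)) side.
    case: ifP => [hd _ E|_]; first by have := lt _ hd; rewrite E ltnn.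
    by case: ifP; rewrite ?eqxx.
  rewrite side; case: ifP => // _.
  by case: ifP => [tl _ E|_]; [have := lt _ tl; rewrite E ltnn | rewrite eqxx].
Qed.
End Graphs.

Theorem theorem3p9 (R : realType) (n : nat) (U : sgraph) (hn : #|U| = n)
    (hU : unicyclic U) :
  (forall o : edge U -> U * U, is_orientation o -> pind_le (B_mx R o) 2) /\
  choosable R U 1 3.
Proof.
have sel (o : edge U -> U * U) : is_orientation o -> per_selectable (B_mx R o) 2.
  exact: unicyclic_per_selectable hU.
split=> [o /sel|]; first exact: per_selectable_pind_le.
have [o oP] := orientation_exists U.
exact: per_selectable_choosable oP (sel o oP).
Qed.
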